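(* Let $\mathbf{X}\in\mathbb{R}^{m\times n}$ be nonzero, fix $p$ with $0<p<1$, and let $\mathbf{X}=\mathbf{L}\boldsymbol{\Sigma}\mathbf{R}^\top$ be a singular value decomposition of $\mathbf{X}$ with singular values $\sigma_1(\mathbf{X})\ge\sigma_2(\mathbf{X})\ge\dots\ge\sigma_{\min(m,n)}(\mathbf{X})\ge0$. Let $\bar d$ be the largest integer such that $$\sigma_{\bar d}(\mathbf{X})>\frac{1-p}{p+(1-p)\bar d}\sum_{i=1}^{\bar d}\sigma_i(\mathbf{X}),$$ and set $\mu=\frac{1-p}{p+(1-p)\bar d}\sum_{i=1}^{\bar d}\sigma_i(\mathbf{X})$. Then the (unique) optimal solution of $$\min_{\mathbf{A}\in\mathbb{R}^{m\times n}}\ \|\mathbf{X}-\mathbf{A}\|_F^2+\frac{1-p}{p}\|\mathbf{A}\|_\star^2$$ is $\mathbf{A}^{\rm opt}=\mathbf{L}\,\mathcal{S}_\mu(\boldsymbol{\Sigma})\,\mathbf{R}^\top$, where $\mathcal{S}_\mu(\sigma)=\max(\sigma-\mu,0)$ is applied entrywise to the singular values on the diagonal of $\boldsymbol{\Sigma}$.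
   Context: $\|\cdot\|_F$ is the Frobenius norm and $\|\cdot\|_\star$ the nuclear norm (sum of singular values). *)

(* Defs.v *)
From HB Require Import structures.
From mathcomp Require Import all_boot all_order all_algebra.
From mathcomp Require Import boolp classical_sets reals.
Set Implicit Arguments. Unset Strict Implicit. Unset Printing Implicit Defensive.
Import Order.TTheory GRing.Theory Num.Theory.
Local Open Scope ring_scope.

Section Defs.
Variable R : realType.

(* k-th diagonal entry (0-indexed) of a rectangular matrix; 0 if k >= min(m,n) *)
Definition diagk m n (S : 'M[R]_(m, n)) (k : nat) : R :=
  \sum_(i < m) \sum_(j < n | (i == k :> nat) && (j == k :> nat)) S i j.

Definition orthogonal_mx n (Q : 'M[R]_n) : Prop := Q^T *m Q = 1%:M.

Definition svd_diag_mx m n (S : 'M[R]_(m, n)) : Prop :=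
  [/\ forall (i : 'I_m) (j : 'I_n), (i : nat) != j -> S i j = 0,
      forall k, 0 <= diagk S k
    & forall k l, (k <= l)%N -> diagk S l <= diagk S k].

Definition is_svd m n (X : 'M[R]_(m, n)) (L : 'M[R]_m) (S : 'M[R]_(m, n))
    (Rt : 'M[R]_n) : Prop :=
  [/\ orthogonal_mx L, orthogonal_mx Rt, svd_diag_mx S & X = L *m S *m Rt^T].

Definition svd_sigma m n (A : 'M[R]_(m, n)) : 'M[R]_(m, n) :=
  xget 0 [set S | exists L Rt, is_svd A L S Rt].

(* i-th singular value, 0-indexed: sigma_{k+1}(A) *)
Definition singval m n (A : 'M[R]_(m, n)) (k : nat) : R := diagk (svd_sigma A) k.

Definition nuc_norm m n (A : 'M[R]_(m, n)) : R :=
  \sum_(k < minn m n) singval A k.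

Definition frob_norm m n (A : 'M[R]_(m, n)) : R :=
  Num.sqrt (\sum_(i < m) \sum_(j < n) A i j ^+ 2).

Definition soft_thresh_diag m n (mu : R) (S : 'M[R]_(m, n)) : 'M[R]_(m, n) :=
  \matrix_(i, j) if (i : nat) == j then Num.max (S i j - mu) 0 else 0.

End Defs.

(* Main.v *)
Require Import Defs.
From HB Require Import structures.
From mathcomp Require Import all_boot all_order all_algebra.
From mathcomp Require Import boolp classical_sets reals.
From mathcomp Require Import complex ring lra.
Set Implicit Arguments. Unset Strict Implicit. Unset Printing Implicit Defensive.
Import Order.TTheory GRing.Theory Num.Theory.
Local Open Scope ring_scope.

(* With [Y = X - Aopt] one has [|X - A|^2 = |Y|^2 - 2 <Y, A - Aopt> + |A - Aopt|^2].
   The choice of [dbar] says exactly that [mu = (1 - p) / p * nuc Aopt], and [Y] has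
   singular values [min sigma_i mu], so duality of the spectral and nuclear norms
   gives [<Y, A> <= mu * nuc A], with equality at [Aopt].  Since
   [(nuc A)^2 >= (nuc Aopt)^2 + 2 nuc Aopt (nuc A - nuc Aopt)], the objective at [A]
   exceeds the one at [Aopt] by at least [|A - Aopt|^2].  As the nuclear norm is
   read off a chosen singular value decomposition, the existence of decompositions
   is needed; it follows by deflation from the spectral theorem over [R[i]]
   applied to the Gram matrix. *)

(** * Orthogonal matrices *)

Lemma orthogonal_mx_tr (R : realType) n (Q : 'M[R]_n) :
  orthogonal_mx Q -> Q *m Q^T = 1%:M.
Proof. exact: mulmx1C. Qed.

Lemma orthogonal_mx_mul (R : realType) n (P Q : 'M[R]_n) :
  orthogonal_mx P -> orthogonal_mx Q -> orthogonal_mx (P *m Q).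
Proof.
move=> hP hQ; rewrite /orthogonal_mx trmx_mul mulmxA -(mulmxA Q^T).
by rewrite hP mulmx1 hQ.
Qed.

Lemma orthogonal_mxT (R : realType) n (Q : 'M[R]_n) :
  orthogonal_mx Q -> orthogonal_mx Q^T.
Proof. by move=> hQ; rewrite /orthogonal_mx trmxK; apply: orthogonal_mx_tr. Qed.

Lemma orthogonal_mx1 (R : realType) n : orthogonal_mx (1%:M : 'M[R]_n).
Proof. by rewrite /orthogonal_mx trmx1 mulmx1. Qed.

Lemma orthogonal_mx_block (R : realType) m n (P : 'M[R]_m) (Q : 'M[R]_n) :
  orthogonal_mx P -> orthogonal_mx Q -> orthogonal_mx (block_mx P 0 0 Q).
Proof.
move=> hP hQ; rewrite /orthogonal_mx tr_block_mx mulmx_block !trmx0.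
by rewrite !mulmx0 !mul0mx !addr0 !add0r hP hQ -scalar_mx_block.
Qed.

Lemma orthogonal_mx_row_norm (R : realType) n (Q : 'M[R]_n) i :
  orthogonal_mx Q -> \sum_j Q i j ^+ 2 = 1.
Proof.
move=> /orthogonal_mx_tr /matrixP /(_ i i); rewrite !mxE eqxx mulr1n => <-.
by apply: eq_bigr => j _; rewrite mxE expr2.
Qed.

(** * Rectangular diagonal matrices *)

Lemma diagk_eq (R : realType) m n (S : 'M[R]_(m, n)) (i : 'I_m) (j : 'I_n) :
  (i : nat) = j -> diagk S i = S i j.
Proof.
move=> ij; rewrite /diagk (bigD1 i) //= (bigD1 j) /=; last by rewrite ij !eqxx.
rewrite big1 => [|k /andP[/andP[_ kj] ki]]; last first.
  by case/eqP: ki; apply: val_inj; rewrite /= (eqP kj).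
rewrite addr0 big1 ?addr0 // => k ki; apply: big1 => l /andP[/eqP ek _].
by case/eqP: ki; apply: val_inj.
Qed.

Lemma diagk_out (R : realType) m n (S : 'M[R]_(m, n)) k :
  (minn m n <= k)%N -> diagk S k = 0.
Proof.
move=> hk; rewrite /diagk big1 // => i _; rewrite big1 // => j /andP[/eqP ik /eqP jk].
have := ltn_ord i; have := ltn_ord j; rewrite ik jk => h1 h2.
by move: hk; rewrite leqNgt leq_min h1 h2.
Qed.

Definition diagonal_mx (R : realType) m n (S : 'M[R]_(m, n)) : Prop :=
  forall (i : 'I_m) (j : 'I_n), (i : nat) != j -> S i j = 0.

(** Turns the sum in the nuclear norm into one over all entries, so that inequalities can be checked
    entry by entry. *)
Lemma sum_diagk (R : realType) m n (S : 'M[R]_(m, n)) : diagonal_mx S ->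
  \sum_(k < minn m n) diagk S k = \sum_i \sum_j S i j.
Proof.
move=> hS; rewrite /diagk exchange_big; apply: eq_bigr => i _ /=.
under eq_bigr => k _ do rewrite big_mkcond /=.
rewrite exchange_big; apply: eq_bigr => j _ /=.
have [ij|ij] := eqVneq (i : nat) (j : nat); last first.
  rewrite hS // big1 // => k _; case: ifP => //.
have ik : (i < minn m n)%N by rewrite leq_min ltn_ord ij ltn_ord.
rewrite (bigD1 (Ordinal ik)) //= -ij !eqxx /= big1 ?addr0 // => k kne.
case: ifP => // /andP[/eqP ek _]; case/eqP: kne; exact: val_inj.
Qed.

Lemma diagonal_entry_ge0 (R : realType) m n (S : 'M[R]_(m, n)) :
  diagonal_mx S -> (forall k, 0 <= diagk S k) -> forall i j, 0 <= S i j.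
Proof.
move=> hS S0 i j; have [ij|/hS ->//] := eqVneq (i : nat) (j : nat).
by rewrite -(diagk_eq _ ij).
Qed.

(** * Frobenius inner product and norm duality *)

Definition mxdot {R : realType} {m n} (A B : 'M[R]_(m, n)) : R :=
  \sum_i \sum_j A i j * B i j.

Lemma mxdot_trace (R : realType) m n (A B : 'M[R]_(m, n)) :
  mxdot A B = \tr (A *m B^T).
Proof.
rewrite /mxtrace; apply: eq_bigr => i _; rewrite mxE.
by apply: eq_bigr => j _; rewrite mxE.
Qed.

Lemma mxdot_orthogonal (R : realType) m n (L : 'M[R]_m) (Q : 'M[R]_n)
    (A B : 'M[R]_(m, n)) : orthogonal_mx L -> orthogonal_mx Q ->
  mxdot (L *m A *m Q^T) (L *m B *m Q^T) = mxdot A B.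
Proof.
move=> hL hQ; rewrite !mxdot_trace !trmx_mul trmxK.
rewrite -!mulmxA (mulmxA Q^T) hQ mul1mx mxtrace_mulC.
by rewrite -!mulmxA hL mulmx1.
Qed.

(** The entry is the sum of [P i a * T a b * Q j b] over diagonal positions. Each term is at most
    [c / 2 * (P i a ^+ 2 + Q j b ^+ 2)], and the rows of [P] and [Q] are unit vectors. *)
Lemma diagonal_conj_entry_le (R : realType) m n (T : 'M[R]_(m, n)) (c : R)
    (P : 'M[R]_m) (Q : 'M[R]_n) i j : diagonal_mx T ->
  (forall a b, 0 <= T a b <= c) -> 0 <= c ->
  orthogonal_mx P -> orthogonal_mx Q -> (P *m T *m Q^T) i j <= c.
Proof.
move=> hT Tc c0 hP hQ.
have -> : (P *m T *m Q^T) i j = \sum_a \sum_b P i a * T a b * Q j b.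
  rewrite mxE exchange_big; apply: eq_bigr => b _.
  by rewrite !mxE mulr_suml.
(* Indicator of the diagonal. In a rectangular matrix some rows or columns miss the diagonal, hence
   sums at most 1 rather than equal to 1. *)
pose d (a : 'I_m) (b : 'I_n) : R := ((a : nat) == b)%:R.
have dsum1 a : \sum_b d a b <= 1.
  have [an|an] := ltnP a n; last first.
    by rewrite big1 // => b _; rewrite /d (gtn_eqF (leq_trans (ltn_ord b) an)).
  rewrite (bigD1 (Ordinal an)) //= big1 /d ?eqxx ?addr0 // => b bne.
  by case: eqP => // ab; case/eqP: bne; apply: val_inj.
have dsum2 b : \sum_a d a b <= 1.
  have [bm|bm] := ltnP b m; last first.
    by rewrite big1 // => a _; rewrite /d (ltn_eqF (leq_trans (ltn_ord a) bm)).
  rewrite (bigD1 (Ordinal bm)) //= big1 /d ?eqxx ?addr0 // => a ane.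
  by case: eqP => // ab; case/eqP: ane; apply: val_inj.
apply: (@le_trans _ _ (\sum_a \sum_b (c / 2 * (P i a ^+ 2 * d a b)
                                   + c / 2 * (Q j b ^+ 2 * d a b)))).
  apply: ler_sum => a _; apply: ler_sum => b _; rewrite /d.
  have [ab|/hT ->] := eqVneq (a : nat) (b : nat); last by rewrite !mulr0 mul0r addr0.
  have /andP[T0 Tle] := Tc a b; rewrite !mulr1.
  have := mulr_ge0 T0 (sqr_ge0 (P i a - Q j b)).
  have : 0 <= (c - T a b) * (P i a ^+ 2 + Q j b ^+ 2).
    by rewrite mulr_ge0 ?subr_ge0 // addr_ge0 ?sqr_ge0.
  nra.
under eq_bigr => a _ do rewrite big_split /=.
rewrite big_split /= [X in _ + X]exchange_big /=.
have c2 : 0 <= c / 2 by rewrite divr_ge0.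
have cE : c = c / 2 * \sum_a P i a ^+ 2 + c / 2 * \sum_b Q j b ^+ 2.
  by rewrite !orthogonal_mx_row_norm //; lra.
rewrite [leRHS]cE.
rewrite !mulr_sumr; apply: lerD; apply: ler_sum => k _;
  rewrite -mulr_sumr -mulr_sumr ler_wpM2l // ?ler_piMr ?sqr_ge0 //.
Qed.

(* Duality between the spectral and the nuclear norm. *)
Lemma mxdot_svd_le (R : realType) m n (L L' : 'M[R]_m) (Q Q' : 'M[R]_n)
    (T S : 'M[R]_(m, n)) (c : R) :
  orthogonal_mx L -> orthogonal_mx L' -> orthogonal_mx Q -> orthogonal_mx Q' ->
  diagonal_mx T -> (forall a b, 0 <= T a b <= c) -> 0 <= c ->
  (forall a b, 0 <= S a b) ->
  mxdot (L *m T *m Q^T) (L' *m S *m Q'^T) <= c * \sum_i \sum_j S i j.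
Proof.
move=> hL hL' hQ hQ' hT Tc c0 S0.
(* Written in the bases [L'] and [Q'], the first matrix can be paired with the bare [S] by
   orthogonal invariance; the bound then holds entrywise. *)
have -> : L *m T *m Q^T =
    L' *m ((L'^T *m L) *m T *m (Q'^T *m Q)^T) *m Q'^T.
  rewrite trmx_mul trmxK !mulmxA orthogonal_mx_tr // mul1mx -!mulmxA.
  by rewrite orthogonal_mx_tr // mulmx1.
rewrite mxdot_orthogonal // mulr_sumr; apply: ler_sum => i _.
rewrite mulr_sumr; apply: ler_sum => j _; apply: ler_wpM2r => //.
by apply: diagonal_conj_entry_le => //; apply: orthogonal_mx_mul => //;
  apply: orthogonal_mxT.
Qed.

Lemma mxdot_gt0 (R : realType) m n (A : 'M[R]_(m, n)) : A != 0 -> 0 < mxdot A A.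
Proof.
move=> A0; have sq0 i j : 0 <= A i j * A i j by rewrite -expr2 sqr_ge0.
have S0 i : 0 <= \sum_j A i j * A i j by rewrite sumr_ge0.
rewrite lt_neqAle eq_sym sumr_ge0 // andbT; apply: contra A0; rewrite psumr_eq0 //.
move=> /allP h; apply/eqP/matrixP => i j; rewrite mxE.
have := h i (mem_index_enum _); rewrite /= psumr_eq0 // => /allP /(_ j).
by rewrite mem_index_enum /= mulf_eq0 orbb => /(_ isT)/eqP.
Qed.

(** * Real eigenvalues of the Gram matrix *)

Lemma char_poly_conj (F : fieldType) n (P A : 'M[F]_n) : P \in unitmx ->
  char_poly (invmx P *m A *m P) = char_poly A.
Proof.
move=> Pu; rewrite /char_poly /char_poly_mx !map_mxM /=.
have PP : map_mx polyC (invmx P) *m map_mx polyC P = 1%:M.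
  by rewrite -map_mxM mulVmx // map_mx1.
have -> : 'X%:M = map_mx polyC (invmx P) *m 'X%:M *m map_mx polyC P.
  by rewrite mul_mx_scalar -scalemxAl PP scalemx1.
rewrite -mulmxBl -mulmxBr !det_mulmx mulrAC -det_mulmx PP det1 mul1r.
by rewrite mul_mx_scalar -scalemxAl PP scalemx1.
Qed.

(** Over [R[i]] the matrix is Hermitian, hence unitarily diagonalizable with real spectrum; the
    factorization descends to [R] because the embedding is injective on polynomials. *)
Lemma symmetric_char_poly_split (R : realType) n (G : 'M[R]_n) : G^T = G ->
  exists d : 'rV[R]_n, char_poly G = \prod_i ('X - (d 0 i)%:P).
Proof.
move=> Gsym; pose C := R[i]; pose Gc : 'M[C]_n := map_mx (real_complex R) G.
have Gherm : Gc \is hermsymmx.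
  apply/is_hermitianmxP; rewrite expr0 scale1r; apply/matrixP => i j.
  rewrite !mxE -[in LHS]Gsym mxE; symmetry; apply/CrealP.
  by apply/complex_realP; exists (G j i).
have dreal := hermitian_spectral_diag_real Gherm.
have /orthomx_spectralP Geq := hermitian_normalmx Gherm.
exists (\row_i complex.Re (spectral_diag Gc 0 i)).
apply: (map_poly_inj (real_complex R)).
rewrite map_char_poly /= -/Gc [in LHS]Geq char_poly_conj ?spectral_unit //.
rewrite char_poly_trig ?diag_mx_is_trig // rmorph_prod /=.
apply: eq_bigr => i _; rewrite rmorphB /= map_polyX map_polyC /= !mxE eqxx mulr1n.
by rewrite RRe_real //; exact: (mxOverP dreal).
Qed.

(** The eigenvalues sum to the trace of [A^T *m A], which is [mxdot A A > 0] up to cyclicity, so the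
    largest one is positive. *)
Lemma gram_max_eigenvalue (R : realType) m n (A : 'M[R]_(m, n)) : A != 0 ->
  exists l : R, [/\ 0 < l, eigenvalue (A^T *m A) l
    & forall l', eigenvalue (A^T *m A) l' -> l' <= l].
Proof.
move=> A0; set G := A^T *m A.
have Gsym : G^T = G by rewrite trmx_mul trmxK.
have [d dE] := symmetric_char_poly_split Gsym.
have eigE l : eigenvalue G l = [exists i, l == d 0 i].
  rewrite eigenvalue_root_char dE -(big_map (d 0) xpredT (fun x => 'X - x%:P)).
  rewrite root_prod_XsubC; apply/mapP/existsP => [[i _ ->]|[i /eqP ->]].
    by exists i.
  by exists i => //; rewrite mem_index_enum.
have n0 : (0 < n)%N.
  case: n A A0 {G Gsym d dE eigE} => // A; rewrite (thinmx0 A) eqxx //.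
(* Both sides are minus the coefficient of degree [n - 1] of the characteristic polynomial. *)
have trG : \tr G = \sum_i d 0 i.
  apply: oppr_inj; rewrite -char_poly_trace // dE.
  rewrite -(big_map (d 0) xpredT (fun x => 'X - x%:P)).
  rewrite -(big_map (d 0) xpredT id) -coefPn_prod_XsubC.
    by rewrite size_map /index_enum -enumT size_enum_ord.
  by rewrite size_map /index_enum -enumT size_enum_ord -lt0n.
have trG0 : 0 < \tr G by rewrite /G mxtrace_mulC -mxdot_trace mxdot_gt0.
pose i0 := Ordinal n0; pose k := [arg max_(i > i0) d 0 i]%O.
have kmax i : d 0 i <= d 0 k by rewrite /k; case: arg_maxP => // j _; apply.
exists (d 0 k); split; last by move=> l'; rewrite eigE => /existsP[i /eqP ->].
  rewrite ltNge; apply/negP => dk; move: trG0; rewrite trG ltNge => /negP; apply.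
  by apply: sumr_le0 => i _; apply: le_trans (kmax i) dk.
by rewrite eigE; apply/existsP; exists k.
Qed.

(** * Existence of singular value decompositions *)

Lemma householder (R : realType) n (u : 'cV[R]_n.+1) : u^T *m u = 1%:M ->
  exists2 Q : 'M[R]_n.+1, orthogonal_mx Q & Q *m delta_mx 0 0 = u.
Proof.
set e : 'cV[R]_n.+1 := delta_mx 0 0 => u1.
have e1 : e^T *m e = 1%:M.
  by rewrite trmx_delta mul_delta_mx; apply/matrixP => i j; rewrite !ord1 !mxE.
have [ue|ue] := eqVneq u e.
  by exists 1%:M; [exact: orthogonal_mx1 | rewrite mul1mx ue].
(* The reflection in the hyperplane orthogonal to [u - e] exchanges the unit vectors [u] and [e]. *)
pose w := u - e; pose s := (w^T *m w) 0 0.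
have wE : w^T *m w = s%:M by rewrite [LHS]mx11_scalar.
have s0 : s != 0.
  rewrite gt_eqF //; have := @mxdot_gt0 _ _ _ w^T; rewrite mxdot_trace trmxK.
  rewrite trace_mx11; apply.
  by rewrite -(inj_eq trmx_inj) trmxK trmx0 subr_eq0.
pose t := (e^T *m u) 0 0.
have euE : e^T *m u = t%:M by rewrite [LHS]mx11_scalar.
have ueE : u^T *m e = t%:M by rewrite -[LHS]trmxK trmx_mul trmxK euE tr_scalar_mx.
have sE : s = 2 * (1 - t).
  have : w^T *m w = (2 * (1 - t))%:M.
    rewrite /w [(u - e)^T]linearB /= mulmxBl !mulmxBr u1 e1 euE ueE -!raddfB /=.
    by congr (_%:M); ring.
  by rewrite wE => /matrixP /(_ 0 0); rewrite !mxE !mulr1n.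
have weE : w^T *m e = (t - 1)%:M.
  by rewrite /w [(u - e)^T]linearB /= mulmxBl ueE e1 -raddfB.
(* Since [w^T *m e] is [t - 1 = - s / 2], this reflection sends [e] to [e + w = u]. *)
pose Q := 1%:M - (2 / s) *: (w *m w^T).
have QT : Q^T = Q by rewrite /Q linearB /= trmx1 linearZ /= trmx_mul trmxK.
exists Q.
  rewrite /orthogonal_mx QT /Q mulmxBl mul1mx mulmxBr mulmx1.
  rewrite -scalemxAl -scalemxAr mulmxA -(mulmxA w) wE mul_mx_scalar.
  rewrite -scalemxAl; move: (w *m w^T) => W; apply/matrixP => i j.
  by rewrite !mxE; field.
rewrite /Q mulmxBl mul1mx -scalemxAl -mulmxA weE mul_mx_scalar scalerA.
rewrite (_ : 2 / s * (t - 1) = -1); first by rewrite scaleN1r opprK addrC subrK.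
have : t - 1 = - (s / 2) by rewrite sE; field.
by move=> ->; field.
Qed.

(** Since [A^T *m A = Q *m (S^T *m S) *m Q^T], row [k] of [Q^T] is a row eigenvector. Deflation uses
    this to see that no later singular value exceeds the first. *)
Lemma diagk_sqr_eigenvalue (R : realType) m n (A : 'M[R]_(m, n)) (L : 'M[R]_m)
    (S : 'M[R]_(m, n)) (Q : 'M[R]_n) k : orthogonal_mx L -> orthogonal_mx Q ->
  diagonal_mx S -> A = L *m S *m Q^T -> (k < minn m n)%N ->
  eigenvalue (A^T *m A) (diagk S k ^+ 2).
Proof.
move=> hL hQ hS ->; rewrite leq_min => /andP[km kn].
pose i := Ordinal km; pose j := Ordinal kn.
have kE : diagk S k = S i j by rewrite -(@diagk_eq _ _ _ S i j).
have -> : (L *m S *m Q^T)^T *m (L *m S *m Q^T) = Q *m (S^T *m S) *m Q^T.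
  rewrite !trmx_mul trmxK -!mulmxA; congr (Q *m (S^T *m _)).
  by rewrite mulmxA hL mul1mx.
apply/eigenvalueP; exists (delta_mx 0 j *m Q^T).
  rewrite !mulmxA -(mulmxA _ Q^T) hQ mulmx1 scalemxAl; congr (_ *m Q^T).
  rewrite -mulmxA -rowE; apply/rowP => l; rewrite !mxE /=.
  rewrite (bigD1 i) //= big1 ?addr0 => [|a ai]; last first.
    by rewrite mxE hS ?mul0r //; apply: contra ai => /eqP ?; apply/eqP/val_inj.
  rewrite mxE -kE; have [->|lj] := eqVneq l j; first by rewrite -kE mulr1 expr2.
  by rewrite mulr0 hS ?mulr0 //; apply: contra lj => /eqP h; apply/eqP/val_inj.
apply/eqP => /(congr1 (mulmx^~ Q)); rewrite -mulmxA hQ mulmx1 mul0mx.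
by move=> /rowP /(_ j); rewrite !mxE !eqxx => /eqP; rewrite oner_eq0.
Qed.

Lemma diagk_block0 (R : realType) m n (s : R) (S : 'M[R]_(m, n)) :
  diagk (block_mx s%:M 0 0 S : 'M[R]_(1 + m, 1 + n)) 0 = s.
Proof.
rewrite (@diagk_eq _ _ _ _ (lshift m 0) (lshift n 0)) //.
by rewrite block_mxEul mxE eqxx mulr1n.
Qed.

Lemma diagk_blockS (R : realType) m n (s : R) (S : 'M[R]_(m, n)) k :
  diagk (block_mx s%:M 0 0 S : 'M[R]_(1 + m, 1 + n)) k.+1 = diagk S k.
Proof.
have [kmn|kmn] := leqP (minn m n) k.
  by rewrite !diagk_out // minnSS ltnS.
move: (kmn); rewrite leq_min => /andP[km kn].
rewrite (@diagk_eq _ _ _ S (Ordinal km) (Ordinal kn)) //.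
rewrite (@diagk_eq _ _ _ _ (rshift 1 (Ordinal km)) (rshift 1 (Ordinal kn))) //.
by rewrite block_mxEdr.
Qed.

Lemma diagonal_block (R : realType) m n (s : R) (S : 'M[R]_(m, n)) :
  diagonal_mx S -> diagonal_mx (block_mx s%:M 0 0 S : 'M[R]_(1 + m, 1 + n)).
Proof.
move=> hS i j; case: (split_ordP i) => a ->; case: (split_ordP j) => b -> /=.
- by rewrite !ord1.
- by rewrite block_mxEur mxE.
- by rewrite block_mxEdl mxE.
- by rewrite block_mxEdr => h; apply: hS; apply: contra h => /eqP /= ->.
Qed.

Lemma zero_svd (R : realType) m n :
  is_svd (0 : 'M[R]_(m, n)) 1%:M 0 1%:M.
Proof.
have d0 k : diagk (0 : 'M[R]_(m, n)) k = 0.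
  by rewrite /diagk big1 // => i _; rewrite big1 // => j _; rewrite mxE.
split; [exact: orthogonal_mx1| exact: orthogonal_mx1| |by rewrite mulmx0 mul0mx].
by split => [i j _|k|k l _]; rewrite ?mxE ?d0.
Qed.

(* Deflation along a top singular pair [(u, v)]: Householder reflections taking
   the first basis vectors to [u] and [v] bring [A] to block diagonal form. *)
Lemma svd_exists (R : realType) m n (A : 'M[R]_(m, n)) :
  exists L S Q, is_svd A L S Q.
Proof.
elim: m n A => [|m IH] n A.
  by rewrite (flatmx0 A); exists 1%:M, 0, 1%:M; apply: zero_svd.
case: n A => [|n] A.
  by rewrite (thinmx0 A); exists 1%:M, 0, 1%:M; apply: zero_svd.
have [->|A0] := eqVneq A 0; first by exists 1%:M, 0, 1%:M; apply: zero_svd.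
have [l [l0 /eigenvalueP[w wE w0] lmax]] := gram_max_eigenvalue A0.
pose s := Num.sqrt l; have s0 : 0 < s by rewrite sqrtr_gt0.
have sE : s ^+ 2 = l by rewrite sqr_sqrtr // ltW.
pose q := (w *m w^T) 0 0.
have q0 : 0 < q by rewrite /q -trace_mx11 -mxdot_trace mxdot_gt0.
(* Right singular vector: the row eigenvector [w], transposed and normalized. *)
pose v := (Num.sqrt q)^-1 *: w^T.
have v1 : v^T *m v = 1%:M.
  rewrite /v [(_ *: _)^T]linearZ /= trmxK -scalemxAl -scalemxAr scalerA -expr2 exprVn.
  by rewrite sqr_sqrtr 1?ltW // [w *m _]mx11_scalar -/q scale_scalar_mx mulVf ?gt_eqF.
have AAv : A^T *m (A *m v) = l *: v.
  rewrite /v -!scalemxAr scalerA mulrC -scalerA; congr (_ *: _).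
  by apply: trmx_inj; rewrite mulmxA trmx_mul trmxK trmx_mul trmxK wE linearZ /= trmxK.
(* Left singular vector; it has norm 1 because [v^T *m A^T *m A *m v] is [l = s ^+ 2]. *)
pose u := s^-1 *: (A *m v).
have Av : A *m v = s *: u by rewrite /u scalerA mulfV ?scale1r // gt_eqF.
have Au : A^T *m u = s *: v.
  by rewrite /u -scalemxAr AAv scalerA -sE expr2 mulKf // gt_eqF.
have u1 : u^T *m u = 1%:M.
  rewrite /u [(_ *: _)^T]linearZ /= -scalemxAl -scalemxAr trmx_mul -mulmxA AAv.
  rewrite -scalemxAr v1 !scalerA -sE (_ : _ * _ = 1) ?scale1r //; field.
  by rewrite gt_eqF.
have [U hU Ue] := householder u1; have [V hV Ve] := householder v1.
pose B : 'M[R]_(m.+1, n.+1) := U^T *m A *m V.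
have AE : A = U *m B *m V^T.
  by rewrite /B !mulmxA orthogonal_mx_tr // mul1mx -mulmxA orthogonal_mx_tr // mulmx1.
have Bcol : B *m delta_mx 0 0 = s *: (delta_mx 0 0 : 'cV_m.+1).
  by rewrite /B -mulmxA Ve -mulmxA Av -scalemxAr -Ue mulmxA hU mul1mx.
have Brow : B^T *m delta_mx 0 0 = s *: (delta_mx 0 0 : 'cV_n.+1).
  rewrite /B !trmx_mul trmxK -!mulmxA Ue Au -scalemxAr -Ve.
  by rewrite mulmxA hV mul1mx.
clearbody B.
pose A' := drsubmx (B : 'M[R]_(1 + m, 1 + n)).
(* [Bcol] fixes the first column and [Brow] the first row, leaving [A'] for the induction. *)
have BE : B = block_mx s%:M 0 0 A' :> 'M[R]_(1 + m, 1 + n).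
  have c0 i (j : 'I_n.+1) : j = 0%N :> nat -> B i j = s * ((i : nat) == 0%N)%:R.
    move=> j0; have -> : j = 0 by apply: val_inj.
    by move/colP: Bcol => /(_ i); rewrite -colE !mxE andbT.
  have r0 (i : 'I_m.+1) j : i = 0%N :> nat -> B i j = s * ((j : nat) == 0%N)%:R.
    move=> i0; have -> : i = 0 by apply: val_inj.
    by move/colP: Brow => /(_ j); rewrite -colE !mxE andbT.
  rewrite -[LHS](@submxK _ 1 m 1 n B); congr block_mx; apply/matrixP => i j;
    rewrite !mxE.
  - by rewrite !ord1 c0 //= mulr1.
  - by rewrite r0 ?mulr0 //= ord1.
  - by rewrite c0 ?mulr0 //= ord1.
have [L' [S' [Q' [hL' hQ' [S'd S'0 S'dec] A'E]]]] := IH n A'.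
pose S : 'M[R]_(1 + m, 1 + n) := block_mx s%:M 0 0 S'.
pose L : 'M[R]_(1 + m) := (U : 'M_(1 + m)) *m block_mx 1%:M 0 0 L'.
pose Q : 'M[R]_(1 + n) := (V : 'M_(1 + n)) *m block_mx 1%:M 0 0 Q'.
have hL : orthogonal_mx L.
  apply: orthogonal_mx_mul => //; apply: orthogonal_mx_block => //.
  exact: orthogonal_mx1.
have hQ : orthogonal_mx Q.
  apply: orthogonal_mx_mul => //; apply: orthogonal_mx_block => //.
  exact: orthogonal_mx1.
have hS : diagonal_mx S by apply: diagonal_block.
have ASE : A = L *m S *m Q^T.
  rewrite AE BE A'E /L /Q /S trmx_mul tr_block_mx !trmx0 trmx1.
  rewrite !mulmxA; congr (_ *m V^T); rewrite -!mulmxA; congr (U *m _).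
  by rewrite !mulmx_block !(mulmx0, mul0mx, mulmx1, mul1mx, addr0, add0r) !mulmxA.
exists L, S, Q; split => //; split => //.
  by case=> [|k]; rewrite /S ?diagk_block0 ?diagk_blockS // ltW.
(* The square of such an entry is an eigenvalue of [A^T *m A], hence at most [l = s ^+ 2]. *)
have top k : diagk S k.+1 <= s.
  have [kmn|kmn] := leqP (minn (1 + m) (1 + n)) k.+1.
    by rewrite diagk_out // ltW.
  have := lmax _ (diagk_sqr_eigenvalue hL hQ hS ASE kmn).
  by rewrite -sE ler_pXn2r // nnegrE; [rewrite /S diagk_blockS | exact: ltW].
case=> [|k] [|j] //= kj; first by rewrite [leRHS]diagk_block0.
by rewrite /S !diagk_blockS S'dec.
Qed.

(** * Bounds on the nuclear norm *)

Lemma svd_sigmaP (R : realType) m n (A : 'M[R]_(m, n)) :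
  exists L Q, is_svd A L (svd_sigma A) Q.
Proof.
have [L [S [Q h]]] := svd_exists A.
(* Existence rules out the default value 0 of [xget]. *)
by apply: (@xgetPex _ 0 [set S | exists L Rt, is_svd A L S Rt]%classic); exists S, L, Q.
Qed.

Lemma nuc_norm_ge0 (R : realType) m n (A : 'M[R]_(m, n)) : 0 <= nuc_norm A.
Proof.
have [L [Q [_ _ [_ S0 _] _]]] := svd_sigmaP A.
by apply: sumr_ge0 => k _; apply: S0.
Qed.

Lemma mxdot_le_nuc_norm (R : realType) m n (A : 'M[R]_(m, n)) (L : 'M[R]_m)
    (T : 'M[R]_(m, n)) (Q : 'M[R]_n) (c : R) :
  orthogonal_mx L -> orthogonal_mx Q ->
  diagonal_mx T -> (forall a b, 0 <= T a b <= c) -> 0 <= c ->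
  mxdot (L *m T *m Q^T) A <= c * nuc_norm A.
Proof.
move=> hL hQ hT Tc c0; have [L' [Q' [hL' hQ' [Sd S0 _] {1}->]]] := svd_sigmaP A.
rewrite /nuc_norm /singval sum_diagk //.
by apply: mxdot_svd_le => //; apply: diagonal_entry_ge0.
Qed.

(** Pairing [A] with [L' *m I *m Q'^T], for [I] the rectangular identity and [L'], [Q'] from the
    chosen decomposition, yields [nuc_norm A]; duality with [c = 1] bounds it. Uniqueness of
    singular values is thereby avoided. *)
Lemma nuc_norm_svd_le (R : realType) m n (L : 'M[R]_m)
    (S : 'M[R]_(m, n)) (Q : 'M[R]_n) : orthogonal_mx L -> orthogonal_mx Q ->
  (forall a b, 0 <= S a b) ->
  nuc_norm (L *m S *m Q^T) <= \sum_i \sum_j S i j.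
Proof.
move=> hL hQ S0; set A := L *m S *m Q^T.
have [L' [Q' [hL' hQ' [Sd _ _] AE]]] := svd_sigmaP A.
pose I : 'M[R]_(m, n) := \matrix_(i, j) ((i : nat) == j)%:R.
have Id : diagonal_mx I by move=> i j /negPf ij; rewrite mxE ij.
have I01 a b : 0 <= I a b <= 1 by rewrite mxE; case: eqP; rewrite ?lexx ?ler01.
have := mxdot_svd_le hL' hL hQ' hQ Id I01 ler01 S0; rewrite mul1r -/A.
apply: le_trans; rewrite AE mxdot_orthogonal // /nuc_norm -AE /singval sum_diagk //.
apply: ler_sum => i _; apply: ler_sum => j _; rewrite mxE.
by have [_|/Sd ->] := eqVneq (i : nat) (j : nat); rewrite ?mul1r ?mulr0.
Qed.

(** * Expansion of the squared Frobenius norm *)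

Lemma frob_norm_sqr (R : realType) m n (A : 'M[R]_(m, n)) :
  frob_norm A ^+ 2 = mxdot A A.
Proof.
rewrite sqr_sqrtr; last by do 2![apply: sumr_ge0 => ? _]; apply: sqr_ge0.
by apply: eq_bigr => i _; apply: eq_bigr => j _; rewrite expr2.
Qed.

Lemma mxdotBr (R : realType) m n (A B C : 'M[R]_(m, n)) :
  mxdot A (B - C) = mxdot A B - mxdot A C.
Proof.
rewrite -sumrB; apply: eq_bigr => i _; rewrite -sumrB.
by apply: eq_bigr => j _; rewrite !mxE mulrBr.
Qed.

Lemma mxdot_sqrB (R : realType) m n (A B : 'M[R]_(m, n)) :
  mxdot (A - B) (A - B) = mxdot A A - mxdot A B *+ 2 + mxdot B B.
Proof.
have mxdotC (C D : 'M[R]_(m, n)) : mxdot C D = mxdot D C.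
  by apply: eq_bigr => i _; apply: eq_bigr => j _; rewrite mulrC.
rewrite mxdotBr (mxdotC _ A) (mxdotC _ B) !mxdotBr (mxdotC B A); ring.
Qed.

(** * Optimality of soft thresholding *)

Theorem theorem4 (R : realType) (m n : nat) (X : 'M[R]_(m, n)) (p : R)
  (L : 'M[R]_m) (Sigma : 'M[R]_(m, n)) (Rt : 'M[R]_n) (dbar : nat) :
  X != 0 -> 0 < p -> p < 1 ->
  is_svd X L Sigma Rt ->
  (* sigma_d(X) = diagk Sigma (d - 1), for 1 <= d <= min(m,n) *)
  (1 <= dbar <= minn m n)%N ->
  diagk Sigma dbar.-1 >
    (1 - p) / (p + (1 - p) * dbar%:R) * \sum_(i < dbar) diagk Sigma i ->
  (forall d : nat, (dbar < d <= minn m n)%N ->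
     ~ (diagk Sigma d.-1 >
          (1 - p) / (p + (1 - p) * d%:R) * \sum_(i < d) diagk Sigma i)) ->
  let mu := (1 - p) / (p + (1 - p) * dbar%:R) * \sum_(i < dbar) diagk Sigma i in
  let Aopt := L *m soft_thresh_diag mu Sigma *m Rt^T in
  let obj := fun A : 'M[R]_(m, n) =>
    frob_norm (X - A) ^+ 2 + (1 - p) / p * nuc_norm A ^+ 2 in
  forall A : 'M[R]_(m, n), A != Aopt -> obj Aopt < obj A.
Proof.
move=> _ p0 p1 [hL hQ [Sd S0 Sdec] XE] /andP[d1 dmn] hd hmax mu Aopt obj A AA.
have sgm0 := diagonal_entry_ge0 Sd S0.
set c := (1 - p) / p in obj *.
have c0 : 0 < c by rewrite divr_gt0 ?subr_gt0.
have den0 (d : nat) : 0 < p + (1 - p) * d%:R.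
  by rewrite ltr_pwDl // mulr_ge0 ?ler0n // subr_ge0 ltW.
have mu0 : 0 <= mu.
  rewrite /mu mulr_ge0 ?sumr_ge0 // divr_ge0 ?subr_ge0 1?ltW //.
pose S := soft_thresh_diag mu Sigma.
(* Off the diagonal the maximum is also 0, because [mu >= 0]. *)
have SE i j : S i j = Num.max (Sigma i j - mu) 0.
  rewrite mxE; case: eqVneq => // /Sd ->; rewrite sub0r.
  by rewrite max_r // oppr_le0.
have Sdiag : diagonal_mx S by move=> i j /negPf ij; rewrite mxE ij.
have Spos i j : 0 <= S i j by rewrite SE le_max lexx orbT.
have diagS k : diagk S k = Num.max (diagk Sigma k - mu) 0.
  have [kmn|] := leqP (minn m n) k.
    by rewrite !diagk_out // sub0r max_r // oppr_le0.
  rewrite leq_min => /andP[km kn].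
  by rewrite !(@diagk_eq _ _ _ _ (Ordinal km) (Ordinal kn)) //= SE.
pose N := \sum_i \sum_j S i j.
(* Clearing the denominator of [mu] gives [p * mu = (1 - p) * (sum - dbar * mu)], with [sum] over
   the first [dbar] singular values; the bracket is [N], as exactly those exceed [mu]. *)
have muN : mu = c * N.
  have muE : mu * (p + (1 - p) * dbar%:R) = (1 - p) * \sum_(i < dbar) diagk Sigma i.
    by rewrite /mu mulrAC mulfVK // gt_eqF.
  have above k : (k < dbar)%N -> mu < diagk Sigma k.
    move=> kd; apply: lt_le_trans hd _; apply: Sdec.
    by rewrite -ltnS prednK.
  have below k : (dbar <= k)%N -> diagk Sigma k <= mu.
    move=> dk; apply: le_trans (Sdec _ _ dk) _.
    (* With 0-indexing [diagk Sigma dbar] is the singular value number [dbar + 1]. Failure of the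
       strict inequality at [dbar.+1] rearranges to [diagk Sigma dbar <= mu]. *)
    have [dmn'|dmn'] := leqP (minn m n) dbar; first by rewrite diagk_out.
    have := hmax dbar.+1; rewrite ltnSn dmn' => /(_ isT)/negP.
    rewrite -leNgt /= big_ord_recr /= mulrAC ler_pdivlMr // -natr1 => h.
    rewrite -(ler_pM2r (den0 dbar)) muE; lra.
  have NE : N = \sum_(k < dbar) (diagk Sigma k - mu).
    rewrite /N -sum_diagk // -(subnKC dmn) big_split_ord /=.
    rewrite [X in _ + X]big1 ?addr0 => [|k _]; last first.
      by rewrite diagS max_r // subr_le0 below // leq_addr.
    by apply: eq_bigr => k _; rewrite diagS max_l // subr_ge0 ltW // above.
  have -> : N = \sum_(k < dbar) diagk Sigma k - dbar%:R * mu.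
    by rewrite NE sumrB sumr_const card_ord mulr_natl.
  have : p * mu = (1 - p) * (\sum_(k < dbar) diagk Sigma k - dbar%:R * mu) by lra.
  by rewrite /c mulrAC => <-; rewrite mulrAC mulfV ?mul1r // gt_eqF.
pose T := Sigma - S.
have TE : X - Aopt = L *m T *m Rt^T by rewrite /T mulmxBr mulmxBl -XE.
have Tdiag : diagonal_mx T by move=> i j ij; rewrite !mxE Sd // (negPf ij) subr0.
have Tc i j : 0 <= T i j <= mu.
  have -> : T i j = Sigma i j - S i j by rewrite !mxE.
  rewrite SE; have := sgm0 i j; case: (lerP (Sigma i j - mu) 0) => h s0; lra.
(* Equality case of duality: entrywise [T = mu] wherever [S] is nonzero. *)
have YA0 : mxdot (X - Aopt) Aopt = mu * N.
  rewrite TE mxdot_orthogonal // /N mulr_sumr; apply: eq_bigr => i _.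
  rewrite mulr_sumr; apply: eq_bigr => j _.
  have -> : T i j = Sigma i j - S i j by rewrite !mxE.
  rewrite SE; case: (lerP (Sigma i j - mu) 0) => h; ring.
have YA : mxdot (X - Aopt) A <= mu * nuc_norm A.
  by rewrite TE; apply: mxdot_le_nuc_norm.
(* An upper bound suffices, since it bounds the objective at [Aopt] from above. *)
have N0 : nuc_norm Aopt <= N by apply: nuc_norm_svd_le.
have nA0 := nuc_norm_ge0 Aopt.
rewrite /obj !frob_norm_sqr.
have -> : X - A = (X - Aopt) - (A - Aopt) by rewrite opprB addrA subrK.
set Y := X - Aopt in YA YA0 *; set D := A - Aopt.
have D0 : 0 < mxdot D D by apply: mxdot_gt0; rewrite subr_eq0.
have YD : mxdot Y D = mxdot Y A - mu * N by rewrite -YA0 -mxdotBr.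
rewrite mxdot_sqrB YD.
have h1 : c * nuc_norm Aopt ^+ 2 <= c * N ^+ 2.
  by rewrite ler_pM2l // ler_pXn2r // nnegrE // (le_trans nA0).
(* Tangent line of the square at [N]: by [muN] the gap is [c * (nuc_norm A - N) ^+ 2]. *)
have h2 : c * N ^+ 2 + (mu * nuc_norm A - mu * N) *+ 2 <= c * nuc_norm A ^+ 2.
  rewrite muN -subr_ge0.
  have := mulr_ge0 (ltW c0) (sqr_ge0 (nuc_norm A - N)); congr (0 <= _); ring.
(* [YA], [h1] and [h2] leave a gap of at least [mxdot D D], and [D0] makes it strict. *)
lra.
Qed.
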